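(* For every integer $n$, the sequence $\{d_n^k\}_{0\le k\le n}$ is $2$-log-concave; that is, for all integers $n\ge 4$ and $2\le k\le n-2$, $$\left((d_n^k)^2-d_n^{k-1}d_n^{k+1}\right)^2-\left((d_n^{k-1})^2-d_n^{k-2}d_n^{k}\right)\left((d_n^{k+1})^2-d_n^{k}d_n^{k+2}\right)\ge 0.$$
   Context: Euler's difference table $(e_n^k)_{0\le k\le n}$ (for integers $n\ge 0$) is defined by $e_n^n=n!$ for $n\ge 0$ and $e_n^{k-1}=e_n^k-e_{n-1}^{k-1}$ for $1\le k\le n$. Define $d_n^k=e_n^k/k!$ for $0\le k\le n$. For a sequence $\{a_k\}$ put $b_k=a_k^2-a_{k-1}a_{k+1}$; $2$-log-concavity refers to log-concavity of the sequence $\{b_k\}$, i.e. $b_k^2\ge b_{k-1}b_{k+1}$. For the finite sequence $\{d_n^k\}_{0\le k\le n}$ this is understood only at those indices where every entry appearing lies in the range $0,\dots,n$, which is exactly the displayed inequality for $n\ge 4$ and $2\le k\le n-2$ (no zero-padding of the sequence outside $0\le k\le n$ is used). *)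

(* Defs.v *)
From mathcomp Require Import all_boot all_order all_algebra.

Set Implicit Arguments.
Unset Strict Implicit.
Unset Printing Implicit Defensive.

Import Order.TTheory GRing.Theory Num.Theory.
Local Open Scope ring_scope.

(* Euler's recurrence e_n^(k-1) = e_n^k - e_(n-1)^(k-1) decreases the gap n - k,
   so we recurse on it: euler_gap j k is e_(k+j)^k. *)
Fixpoint euler_gap (j k : nat) : int :=
  if j is j'.+1 then euler_gap j' k.+1 - euler_gap j' k else (k`!)%:Z.

(* e_n^k; only meaningful for k <= n. *)
Definition euler (n k : nat) : int := euler_gap (n - k) k.

Lemma euler_diag n : euler n n = (n`!)%:Z.
Proof. by rewrite /euler subnn. Qed.

Lemma euler_rec n k : (1 <= k <= n)%N ->
  euler n k.-1 = euler n k - euler n.-1 k.-1.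
Proof.
by case: k => [|k] //; case: n => [|n] //= kn; rewrite /euler subSS subSn.
Qed.

Definition euler_d (n k : nat) : rat := (euler n k)%:Q / (k`!)%:Q.

(* Main.v *)
Require Import Defs.
From mathcomp Require Import all_boot all_order all_algebra.
From mathcomp Require Import ring lra zify.

Import Order.TTheory GRing.Theory Num.Theory.
Local Open Scope ring_scope.

(** Fix [k] and [n], put [j = n - k] and [(p, q, r) = (d_n^k, d_(n-1)^k, d_(n-2)^k)].
    Besides the defining recurrence, the table satisfies
    [e_n^k = k e_(n-1)^(k-1) + (n - k) e_(n-1)^k]; together they give
    [p = (n - 1) q + (j - 1) r] and express [d_n^(k-2), ..., d_n^(k+2)] linearly in
    [p, q, r].  Up to positive factors the entries [b_(k-1), b_k, b_(k+1)] become
    [(k - 2) p^2 + 2 j p q + j^2 q^2 - j (j - 1) p r],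
    [p^2 + (j - 1) p r - j q^2] and [p^2 + 2 p q + (k + 2) q^2 - (k + 1) p r].
    Since [q^2 <= p r], these are at most [(k - 2) p^2 + 2 j p q + j q^2],
    at least [p^2 - q^2], and at most [(p + q)^2] respectively, so the claim reduces to
    [4 p^2 - 2 (n + 2) p q + (k + 2 - j) q^2 >= 0], which holds as [p >= (n - 1) q]. *)

Lemma euler_gapS j k :
  euler_gap j.+1 k = euler_gap j k.+1 - euler_gap j k.
Proof. by []. Qed.

Lemma euler_gap_pascal j k :
  euler_gap j.+1 k.+1 = k.+1%:Z * euler_gap j.+1 k + j.+1%:Z * euler_gap j k.+1.
Proof.
elim: j k => [|j IHj] k.
  by rewrite /= !factS !PoszM; ring.
(* The induction hypothesis, used at [k.+1] and at [k], reduces everything to [euler_gap j.+1 k.+1]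
   and [euler_gap j.+1 k]. *)
have gjk1 : j.+1%:Z * euler_gap j k.+1
    = euler_gap j.+1 k.+1 - k.+1%:Z * euler_gap j.+1 k by rewrite IHj; ring.
have gjk2 : euler_gap j k.+2 = euler_gap j.+1 k.+1 + euler_gap j k.+1.
  by rewrite (euler_gapS j k.+1); ring.
rewrite !(euler_gapS j.+1) (IHj k.+1) gjk2 (mulrDr j.+1%:Z) gjk1; ring.
Qed.

(** Eliminating column [k.+1] between the two recurrences; for [k = 0] this is the derangement
    recurrence. *)
Lemma euler_gap_column j k :
  euler_gap j.+2 k
    = (k + j).+1%:Z * euler_gap j.+1 k + j.+1%:Z * euler_gap j k.
Proof. by rewrite euler_gapS euler_gap_pascal (euler_gapS j k); ring. Qed.

(** In [euler_gap_column] the last term is positive, and it is at most [euler_gap j.+1 k] because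
    [j.+1 <= k + j]. At [k = 0] positivity fails: [euler_gap 1 0 = 0]. *)
Lemma euler_gap_bounds j k : (0 < k)%N ->
  [/\ 0 < euler_gap j k,
      (k + j)%:Z * euler_gap j k <= euler_gap j.+1 k
    & euler_gap j.+1 k <= (k + j).+1%:Z * euler_gap j k].
Proof.
move=> k_gt0; elim: j => [|j [g_gt0 lbg ubg]].
  have := fact_gt0 k; rewrite /= factS PoszM; split; nia.
have g1_gt0 : 0 < euler_gap j.+1 k by nia.
rewrite euler_gap_column; split=> //; nia.
Qed.

(** The factor [k + 2] balances the scalings of b_(k-1), b_k, b_(k+1), which are 1, k + 1 and (k +
    1)^2 (k + 2), up to a common k!^2. *)
Lemma turan_product_le_sqr (R : realFieldType) (k j p q r : R) :
    2 <= k -> 2 <= j -> 0 < r -> (k + j - 2) * r <= q -> q <= (k + j - 1) * r ->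
    p = (k + j - 1) * q + (j - 1) * r ->
  ((k - 2) * p ^+ 2 + 2 * j * p * q + j ^+ 2 * q ^+ 2 - j * (j - 1) * p * r)
    * (p ^+ 2 + 2 * p * q + (k + 2) * q ^+ 2 - (k + 1) * p * r)
  <= (k + 2) * (p ^+ 2 + (j - 1) * p * r - j * q ^+ 2) ^+ 2.
Proof.
move=> k2 j2 r0 lq uq pE.
have q0 : 0 < q by nra.
have lp : (k + j - 1) * q <= p by rewrite pE; nra.
have p0 : 0 < p by nra.
have qp : q <= p by nra.
have qqpr : q ^+ 2 <= p * r.
  have : (k + j - 1) * q * r <= p * r by rewrite ler_pM2r.
  have : q * q <= (k + j - 1) * r * q by rewrite ler_pM2r.
  nra.
have pq0 : 0 < p * q by apply: mulr_gt0.
have p20 : 0 < p ^+ 2 by apply: exprn_gt0.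
have q20 : 0 < q ^+ 2 by apply: exprn_gt0.
set bm := _ - j * _ * p * r; set b1 := _ - (k + 1) * p * r; set b0 := _ - j * _.
have b1_ge0 : 0 <= b1.
  (* [p >= (k + j - 1) * (k + j - 2) * r], where [k + j - 2 >= 2] and [k + j - 1 >= k + 1]. *)
  have kr : (k + 1) * r <= p.
    have : (k + 1) * r <= (k + j - 1) * r by rewrite ler_pM2r //; lra.
    have : 2 * ((k + j - 1) * r) <= (k + j - 2) * ((k + j - 1) * r) by nra.
    nra.
  have : (k + 1) * r * p <= p * p by rewrite ler_pM2r.
  rewrite /b1; nra.
have ub1 : b1 <= (p + q) ^+ 2 by rewrite /b1; nra.
have ubm : bm <= (k - 2) * p ^+ 2 + 2 * j * (p * q) + j * q ^+ 2.
  have : j * (j - 1) * q ^+ 2 <= j * (j - 1) * (p * r).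
    by rewrite ler_pM2l //; nra.
  rewrite /bm; nra.
have ubm_ge0 : 0 <= (k - 2) * p ^+ 2 + 2 * j * (p * q) + j * q ^+ 2 by nra.
have lb0 : (p - q) * (p + q) <= b0.
  have : (j - 1) * q ^+ 2 <= (j - 1) * (p * r) by rewrite ler_pM2l //; lra.
  rewrite /b0; nra.
(* [bm] is bounded first, against [b1 >= 0]; then [b1], against the nonnegative bound of [bm]. *)
apply: (@le_trans _ _ (((k - 2) * p ^+ 2 + 2 * j * (p * q) + j * q ^+ 2)
                        * (p + q) ^+ 2)).
  apply: (@le_trans _ _ (((k - 2) * p ^+ 2 + 2 * j * (p * q) + j * q ^+ 2) * b1)).
    exact: ler_wpM2r.
  exact: ler_wpM2l.
apply: (@le_trans _ _ ((k + 2) * ((p - q) * (p + q)) ^+ 2)); last first.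
  rewrite ler_wpM2l //; first by lra.
  by rewrite ler_sqr // nnegrE; nra.
rewrite exprMn [leRHS]mulrA ler_wpM2r ?sqr_ge0 // -subr_ge0.
have -> : (k + 2) * (p - q) ^+ 2
    - ((k - 2) * p ^+ 2 + 2 * j * (p * q) + j * q ^+ 2)
    = p * (4 * p - 2 * (k + j + 2) * q) + (k + 2 - j) * q ^+ 2 by ring.
have slope : (2 * (k + j) - 8) * q <= 4 * p - 2 * (k + j + 2) * q by lra.
have n8 : 0 <= 2 * (k + j) - 8 by lra.
have : (k + j - 1) * q * ((2 * (k + j) - 8) * q)
        <= p * (4 * p - 2 * (k + j + 2) * q).
  by apply: ler_pM => //; nra.
(* With n = k + j, [k >= 2] gives k + 2 - j >= 6 - n, so the coefficient is at least (2n - 7)(n - 2)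
   > 0. *)
suff : 0 <= ((k + j - 1) * (2 * (k + j) - 8) + (k + 2 - j)) * q ^+ 2 by lra.
by rewrite mulr_ge0 ?sqr_ge0 //; nra.
Qed.

Lemma euler_dE j k : euler_d (k + j) k = (euler_gap j k)%:Q / (k`!)%:Q.
Proof. by rewrite /euler_d /euler addKn. Qed.

Theorem theorem2p3 (n k : nat) (hn : (4 <= n)%N) (hk2 : (2 <= k)%N)
    (hkn : (k <= n - 2)%N) :
  0 <= (euler_d n k ^+ 2 - euler_d n (k - 1) * euler_d n (k + 1)) ^+ 2
       - (euler_d n (k - 1) ^+ 2 - euler_d n (k - 2) * euler_d n k)
         * (euler_d n (k + 1) ^+ 2 - euler_d n k * euler_d n (k + 2)).
Proof.
have [m km] : exists m, k = m.+2 by exists (k - 2)%N; lia.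
have [i ni] : exists i, n = (k + i.+2)%N by exists (n - k - 2)%N; lia.
have -> : (k - 1)%N = m.+1 by lia.
have -> : (k - 2)%N = m by lia.
rewrite !addnS addn0.
have -> : euler_d n k.+2 = (euler_gap i k.+2)%:Q / (k.+2`!)%:Q.
  by rewrite -euler_dE; congr euler_d; lia.
have -> : euler_d n k.+1 = (euler_gap i.+1 k.+1)%:Q / (k.+1`!)%:Q.
  by rewrite -euler_dE; congr euler_d; lia.
have -> : euler_d n k = (euler_gap i.+2 k)%:Q / (k`!)%:Q.
  by rewrite -euler_dE ni.
have -> : euler_d n m.+1 = (euler_gap i.+3 m.+1)%:Q / (m.+1`!)%:Q.
  by rewrite -euler_dE; congr euler_d; lia.
have -> : euler_d n m = (euler_gap i.+4 m)%:Q / (m`!)%:Q.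
  by rewrite -euler_dE; congr euler_d; lia.
have /(euler_gap_bounds i) [r0 lq uq] : (0 < k)%N by lia.
have pE := euler_gap_column i k.
have e1 : euler_gap i.+1 k.+1 = euler_gap i.+2 k + euler_gap i.+1 k.
  by rewrite (euler_gapS i.+1); ring.
have e2 : euler_gap i k.+2
    = euler_gap i.+2 k + 2 * euler_gap i.+1 k + euler_gap i k.
  by rewrite (euler_gapS i.+1) !(euler_gapS i); ring.
(* Both lower entries are reached through e_(n+1)^k, which [euler_gap_column] expresses by p and
   q. *)
have em1 : k%:Z * euler_gap i.+3 m.+1
    = m.+1%:Z * euler_gap i.+2 k + i.+2%:Z * euler_gap i.+1 k.
  have h := euler_gap_pascal i.+2 m.+1.
  rewrite -km euler_gap_column in h.
  have -> : k%:Z * euler_gap i.+3 m.+1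
      = k%:Z * euler_gap i.+3 m.+1 + i.+3%:Z * euler_gap i.+2 k
        - i.+3%:Z * euler_gap i.+2 k by ring.
  by rewrite -h km; ring.
have em2 : m.+1%:Z * euler_gap i.+4 m
    = (k + i.+1).+1%:Z * euler_gap i.+2 k + i.+2%:Z * euler_gap i.+1 k
      - i.+4.+1%:Z * euler_gap i.+3 m.+1.
  rewrite -euler_gap_column km.
  have -> : euler_gap i.+3 m.+2 = euler_gap i.+4 m.+1 + euler_gap i.+3 m.+1.
    by rewrite (euler_gapS i.+3); ring.
  by rewrite euler_gap_pascal; ring.
rewrite e1 e2 {e1 e2}.
move: (euler_gap i.+2 k) (euler_gap i.+1 k) (euler_gap i k)
  (euler_gap i.+3 m.+1) (euler_gap i.+4 m) r0 lq uq pE em1 em2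
  => p q r d1 d2 r0 lq uq pE em1 em2.
have M1 : 0 < m%:R + 1 :> rat by rewrite ltr_wpDl.
have M2 : 0 < m%:R + 2 :> rat by rewrite ltr_wpDl.
have f0 : 0 < (m`!)%:R :> rat by rewrite ltr0n fact_gt0.
have d1E : d1%:Q = ((m%:R + 1) * p%:Q + (i%:R + 2) * q%:Q) / (m%:R + 2).
  apply: (canRL (mulfK _)); first by rewrite gt_eqF.
  have := congr1 (fun x : int => x%:Q) em1.
  rewrite km !(rmorphM, rmorphD) /= !pmulrn; move=> h; lra.
have d2E : d2%:Q = ((m%:R + i%:R + 4) * p%:Q + (i%:R + 2) * q%:Q
                    - (i%:R + 5) * d1%:Q) / (m%:R + 1).
  apply: (canRL (mulfK _)); first by rewrite gt_eqF.
  have := congr1 (fun x : int => x%:Q) em2.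
  rewrite km !(rmorphM, rmorphD, rmorphB) /= !pmulrn; move=> h; lra.
have pEq : p%:Q = (m%:R + 2 + (i%:R + 2) - 1) * q%:Q + (i%:R + 2 - 1) * r%:Q.
  rewrite pE km !(rmorphM, rmorphD) /= !pmulrn; lra.
have r0q : 0 < r%:Q by rewrite ltr0z.
have lqq : (m%:R + 2 + (i%:R + 2) - 2) * r%:Q <= q%:Q.
  move: lq; rewrite km -(ler_int rat) !(rmorphM, rmorphD) /= !pmulrn => h; lra.
have uqq : q%:Q <= (m%:R + 2 + (i%:R + 2) - 1) * r%:Q.
  move: uq; rewrite km -(ler_int rat) !(rmorphM, rmorphD) /= !pmulrn => h; lra.
have k2 : 2 <= m%:R + 2 :> rat by rewrite lerDr.
have j2 : 2 <= i%:R + 2 :> rat by rewrite lerDr.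
have core := turan_product_le_sqr _ _ _ _ _ _ k2 j2 r0q lqq uqq pEq.
rewrite -subr_ge0 in core.
(* As k = m + 2, this is 1 / (k!^4 (k + 1)^2 (k + 2)), the exact ratio of the goal to [core]. *)
pose c : rat := (((m%:R + 2) * (m%:R + 1) * (m`!)%:R) ^+ 4
                 * (m%:R + 3) ^+ 2 * (m%:R + 4))^-1.
have c0 : 0 <= c.
  by rewrite invr_ge0 !(mulr_ge0, exprn_ge0) // addr_ge0.
apply: le_trans (mulr_ge0 c0 core) _; rewrite le_eqVlt; apply/orP; left; apply/eqP.
rewrite d2E d1E km !factS !PoszM !(rmorphM, rmorphD) /= pEq /c -!pmulrn.
by field; apply/and5P; split; apply: lt0r_neq0; lra.
Qed.
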